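(* Let $(X,\omega)$ be a connected Kähler manifold (without boundary) of complex dimension $n\ge1$. If \[ \mathrm{Ric}_\omega\geq(n+1)\,\omega\qquad\text{or}\qquad H_\omega\geq 2, \] then $\mu_{\mathrm{RC}}(x)\geq \dfrac{n+1}{n}$ for all $x\in X$.
   Context: Conventions: the Kähler form is $\omega=\sqrt{-1}\,g_{i\bar j}\,dz^i\wedge d\bar z^j$, and $\langle u,v\rangle=g_{i\bar j}u^i\overline{v^j}$ is the induced Hermitian inner product on $T^{1,0}_xX$. The curvature is $R_{i\bar j k\bar l}=-\partial_i\partial_{\bar j}g_{k\bar l}+g^{p\bar q}\partial_i g_{k\bar q}\,\partial_{\bar j}g_{p\bar l}$, and for $u\in T^{1,0}_xX$ the endomorphism $R(u,\bar u)\in\mathrm{End}(T^{1,0}_xX)$ is defined by $\langle R(u,\bar u)v,w\rangle=R(u,\bar u,v,\bar w)$. The Ricci curvature is $R_{i\bar j}=g^{k\bar l}R_{i\bar jk\bar l}$, and $\mathrm{Ric}_\omega\ge (n+1)\omega$ means $R_{i\bar j}u^i\overline{u^j}\ge (n+1)|u|^2$ for all $(1,0)$ vectors $u$. The holomorphic sectional curvature is $H_\omega(u)=R(u,\bar u,u,\bar u)/|u|^4$ for $0\neq u\in T^{1,0}_xX$, and $H_\omega\ge 2$ means this is at least $2$ for all $x$ and $u$. Mean RC curvature: let $\mathcal B_x$ be the set of non-negative Hermitian endomorphisms $B$ of $T^{1,0}_xX$ with $\operatorname{tr}B=1$. For $B\in\mathcal B_x$ put $R_B=\sum_{i,j}B^{i\bar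 j}R_{i\bar j}\in\mathrm{End}(T_x^{1,0}X)$ (here $R_{i\bar j}$ denotes the endomorphism-valued components of the curvature of $T^{1,0}X$); equivalently, if $u_1,\dots,u_n$ is a unitary eigenbasis of $B$ with eigenvalues $b_1,\dots,b_n$, then $R_B=\sum_i b_iR(u_i,\bar u_i)$. Define \[ \mu_{\mathrm{RC}}(x)=\max_{B\in\mathcal B_x}\ \min_{0\ne v\in T^{1,0}_xX}\frac{\langle R_Bv,v\rangle}{|v|^2}. \] *)

(* Defs.v *)
From HB Require Import structures.
From mathcomp Require Import all_boot all_order all_algebra.
From mathcomp Require Import all_classical all_reals all_analysis.
From mathcomp Require Import complex.

Set Implicit Arguments.
Unset Strict Implicit.
Unset Printing Implicit Defensive.
Import Order.TTheory GRing.Theory Num.Theory numFieldNormedType.Exports.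

Local Open Scope classical_set_scope.
Local Open Scope ring_scope.

(* R[i] as a normed space over itself, so that 'rV[R[i]]_n is a complex normed
   space and [differentiable] on it means complex (Frechet) differentiable. *)
Set Warnings "-redundant-canonical-projection".
HB.instance Definition _ (R : realType) := NormedModule.copy R[i] R[i]^o.
Set Warnings "redundant-canonical-projection".

Section RealCalculus.
Variables (R : realType) (n : nat).
Implicit Types (f : 'rV[R[i]]_n -> R[i]) (v z : 'rV[R[i]]_n).
Implicit Types (D : set 'rV[R[i]]_n).

Definition line_re f v z (t : R) : R := complex.Re (f (z + (t%:C)%C *: v)).
Definition line_im f v z (t : R) : R := complex.Im (f (z + (t%:C)%C *: v)).

(* Derivative along a real direction v of C^n = R^2n; this is only real-linear
   in v, unlike the library's ['D_v f], which is complex-linear here. *)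
Definition rderivable f v z :=
  derivable (line_re f v z) 0 1 /\ derivable (line_im f v z) 0 1.

Definition rderive f v z : R[i] :=
  (derive1 (line_re f v z) 0 +i* derive1 (line_im f v z) 0)%C.

Fixpoint Ck (k : nat) D f : Prop :=
  (forall z, D z -> {for z, continuous f}) /\
  (if k is k'.+1 then
     forall v, (forall z, D z -> rderivable f v z) /\ Ck k' D (rderive f v)
   else True).

Definition smooth D f := forall k, Ck k D f.

Definition basis_vec (i : 'I_n) : 'rV[R[i]]_n := delta_mx 0 i.

(* d/dz^i = (d/dx^i - sqrt(-1) d/dy^i) / 2 and its conjugate. *)
Definition dz (i : 'I_n) f z : R[i] :=
  (rderive f (basis_vec i) z
   - 'i%C * rderive f ('i%C *: basis_vec i) z) / 2%:R.

Definition dzbar (i : 'I_n) f z : R[i] :=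
  (rderive f (basis_vec i) z
   + 'i%C * rderive f ('i%C *: basis_vec i) z) / 2%:R.

End RealCalculus.

(* Tensors in the coordinates of a chart.  A (1,0) vector u^i d/dz^i is the row
   vector of its components, and an endomorphism A is the matrix for which A v
   is the row [v *m A], so [A k p] is the component A_k^p.  The Hermitian metric
   is the matrix [G] with [G i j] = g_{i jbar}. *)
Section Tensors.
Variables (R : realType) (n : nat).
Implicit Types (G B : 'M[R[i]]_n) (u v w s : 'rV[R[i]]_n).

Definition herm G u v : R[i] :=
  \sum_i \sum_j G i j * u 0 i * ((v 0 j)^*)%C.

Lemma herm_mx G u v : herm G u v = (u *m G *m (map_mx (@conjc R) v)^T) 0 0.
Proof.
rewrite /herm mxE exchange_big; apply: eq_bigr => j _ /=.
rewrite !mxE mulr_suml; apply: eq_bigr => i _.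
by rewrite (mulrC (G i j)).
Qed.

Definition normsq G u : R := complex.Re (herm G u u).

Definition hermitian_posdef G :=
  (forall i j, G j i = ((G i j)^*)%C) /\ (forall u, u != 0 -> 0 < herm G u u).

(* g^{p qbar}, normalised by sum_q g^{p qbar} g_{k qbar} = delta^p_k. *)
Definition ginv G (p q : 'I_n) : R[i] := invmx G q p.

(* R_{i jbar k lbar} at z, for a metric given by the matrix field [g]. *)
Definition curv (g : 'rV[R[i]]_n -> 'M[R[i]]_n) (z : 'rV[R[i]]_n)
    (i j k l : 'I_n) : R[i] :=
  - dz i (dzbar j (fun y => g y k l)) z
  + \sum_p \sum_q ginv (g z) p q
      * dz i (fun y => g y k q) z * dzbar j (fun y => g y p l) z.

Section Curvature.
Variables (G : 'M[R[i]]_n) (Rm : 'I_n -> 'I_n -> 'I_n -> 'I_n -> R[i]).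

(* R(u, vbar, w, sbar) *)
Definition curv4 u v w s : R[i] :=
  \sum_i \sum_j \sum_k \sum_l
    Rm i j k l * u 0 i * ((v 0 j)^*)%C * w 0 k * ((s 0 l)^*)%C.

Definition ricci (i j : 'I_n) : R[i] :=
  \sum_k \sum_l ginv G k l * Rm i j k l.

Definition ricci_quad u : R :=
  complex.Re (\sum_i \sum_j ricci i j * u 0 i * ((u 0 j)^*)%C).

Definition hol_sect u : R := complex.Re (curv4 u u u u) / normsq G u ^+ 2.

(* The component R_{i jbar} of the curvature, as an endomorphism: its (k, p)
   entry is g^{p lbar} R_{i jbar k lbar}. *)
Definition curv_comp (i j : 'I_n) : 'M[R[i]]_n :=
  \matrix_(k, p) \sum_l ginv G p l * Rm i j k l.

(* R(u, ubar) *)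
Definition curv_end u : 'M[R[i]]_n :=
  \sum_i \sum_j (u 0 i * ((u 0 j)^*)%C) *: curv_comp i j.

Lemma curv_compG i j k l : G \in unitmx ->
  (curv_comp i j *m G) k l = Rm i j k l.
Proof.
move=> uG.
have -> : curv_comp i j = (\matrix_(k, l) Rm i j k l) *m invmx G.
  apply/matrixP => a b; rewrite !mxE; apply: eq_bigr => c _.
  by rewrite mxE mulrC.
by rewrite -mulmxA mulVmx // mulmx1 mxE.
Qed.

Lemma curv_endE u v w : G \in unitmx ->
  herm G (v *m curv_end u) w = curv4 u u v w.
Proof.
move=> uG; rewrite herm_mx /curv_end /curv4.
rewrite mulmx_sumr !mulmx_suml summxE; apply: eq_bigr => i _.
rewrite mulmx_sumr !mulmx_suml summxE; apply: eq_bigr => j _.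
rewrite -(mulmxA v) -!scalemxAl -scalemxAr -scalemxAl mxE.
rewrite [X in _ * X]mxE mulr_sumr exchange_big; apply: eq_bigr => l _ /=.
rewrite ![in LHS]mxE mulr_suml mulr_sumr; apply: eq_bigr => k _.
rewrite curv_compG // !mulrA; congr (_ * _).
by rewrite -!mulrA [RHS]mulrC -!mulrA.
Qed.

(* B^{i jbar} = g^{k jbar} B_k^i *)
Definition raise B (i j : 'I_n) : R[i] := \sum_k ginv G k j * B k i.

Definition curv_mean B : 'M[R[i]]_n :=
  \sum_i \sum_j raise B i j *: curv_comp i j.

(* For a unitary eigenbasis e with eigenvalues b: R_B = sum_p b_p R(e_p, ebar_p). *)
Lemma curv_meanE B (e : 'I_n -> 'rV[R[i]]_n) (b : 'I_n -> R[i]) :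
  (forall p q, herm G (e p) (e q) = (p == q)%:R) ->
  (forall p, e p *m B = b p *: e p) ->
  curv_mean B = \sum_p b p *: curv_end (e p).
Proof.
move=> he hb.
pose E := \matrix_(p, i) e p 0 i.
have rE p : row p E = e p by apply/rowP => i; rewrite !mxE.
have EGE : E *m G *m (map_mx (@conjc R) E)^T = 1%:M.
  apply/matrixP => p q; rewrite [RHS]mxE -he herm_mx.
  rewrite -!rE -row_mul !mxE; apply: eq_bigr => j _; by rewrite !mxE.
have Ginv : invmx G = (map_mx (@conjc R) E)^T *m E.
  have h : G *m ((map_mx (@conjc R) E)^T *m E) = 1%:M.
    by rewrite mulmxA; apply: mulmx1C; rewrite mulmxA.
  have [uG _] := mulmx1_unit h.
  by rewrite -[LHS]mulmx1 -h (mulmxA _ G) mulVmx // mul1mx.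
have EB : E *m B = \matrix_(p, i) (b p * e p 0 i).
  by apply/row_matrixP => p; rewrite row_mul rE hb; apply/rowP => i; rewrite !mxE.
have rB i j : raise B i j = \sum_p b p * (e p 0 i * ((e p 0 j)^*)%C).
  transitivity ((invmx G *m B) j i); first by rewrite mxE.
  rewrite Ginv -mulmxA EB mxE; apply: eq_bigr => p _.
  by rewrite !mxE mulrCA (mulrC (conjc _)).
rewrite /curv_mean /curv_end.
under [RHS]eq_bigr => p _ do rewrite scaler_sumr.
rewrite [RHS]exchange_big; apply: eq_bigr => i _ /=.
under [RHS]eq_bigr => p _ do rewrite scaler_sumr.
rewrite [RHS]exchange_big; apply: eq_bigr => j _ /=.
rewrite rB scaler_suml; apply: eq_bigr => p _.
by rewrite scalerA.
Qed.

Definition mean_weights : set 'M[R[i]]_n :=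
  [set B | [/\ forall u v, herm G (u *m B) v = herm G u (v *m B),
               forall u, 0 <= herm G (u *m B) u & \tr B = 1]].

Definition rayleigh B v : R :=
  complex.Re (herm G (v *m curv_mean B) v) / normsq G v.

(* The maximum and the minimum are taken as sup and inf in \bar R (they are
   attained, by compactness). *)
Definition mu_rc : \bar R :=
  ereal_sup [set ereal_inf [set (rayleigh B v)%:E | v in [set v | v != 0]]
            | B in mean_weights].

End Curvature.
End Tensors.

Record chart (R : realType) (X : topologicalType) (n : nat) := Chart {
  dom : set X;
  img : set 'rV[R[i]]_n;
  coord : X -> 'rV[R[i]]_n;
  param : 'rV[R[i]]_n -> X;
  dom_open : open dom;
  img_open : open img;
  coordK : forall x, dom x -> img (coord x) /\ param (coord x) = x;
  paramK : forall z, img z -> dom (param z) /\ coord (param z) = z;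
  coord_continuous : forall x, dom x -> {for x, continuous coord};
  param_continuous : forall z, img z -> {for z, continuous param}
}.

Definition transition (R : realType) (X : topologicalType) (n : nat)
  (a b : chart R X n) : 'rV[R[i]]_n -> 'rV[R[i]]_n := coord b \o param a.

Definition overlap (R : realType) (X : topologicalType) (n : nat)
  (a b : chart R X n) : set 'rV[R[i]]_n := img a `&` param a @^-1` dom b.

Record complexManifold (R : realType) (X : topologicalType) (n : nat) :=
  ComplexManifold {
  atlas : set (chart R X n);
  manifold_hausdorff : hausdorff_space X;
  manifold_second_countable : @second_countable X;
  atlas_cover : forall x : X, exists2 a, atlas a & dom a x;
  atlas_holomorphic : forall a b, atlas a -> atlas b ->
    forall z, overlap a b z -> differentiable (transition a b) z
}.

(* [metric a z i j] is g_{i jbar} at the point with coordinates z in the chart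
   a.  The two conditions [metric_closed] and [metric_closed_bar] are the (2,1)
   and (1,2) parts of d omega = 0. *)
Record kahlerMetric (R : realType) (X : topologicalType) (n : nat)
  (M : complexManifold R X n) := KahlerMetric {
  metric : chart R X n -> 'rV[R[i]]_n -> 'M[R[i]]_n;
  metric_smooth : forall a, atlas M a -> forall i j,
    smooth (img a) (fun z => metric a z i j);
  metric_posdef : forall a, atlas M a -> forall z, img a z ->
    hermitian_posdef (metric a z);
  metric_transition : forall a b, atlas M a -> atlas M b ->
    forall z, overlap a b z ->
    let J := jacobian (transition a b) z in
    metric a z
      = J *m metric b (transition a b z) *m (map_mx (@conjc R) J)^T;
  metric_closed : forall a, atlas M a -> forall z, img a z -> forall i j k,
    dz k (fun y => metric a y i j) z = dz i (fun y => metric a y k j) z;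
  metric_closed_bar : forall a, atlas M a -> forall z, img a z ->
    forall i j k,
    dzbar k (fun y => metric a y i j) z = dzbar j (fun y => metric a y i k) z
}.

(* Pointwise notions at x, computed in a chart a around x. *)
Section Pointwise.
Variables (R : realType) (X : topologicalType) (n : nat).
Variables (M : complexManifold R X n) (omega : kahlerMetric M).

Definition metric_at (a : chart R X n) (x : X) : 'M[R[i]]_n :=
  metric omega a (coord a x).

Definition curv_at (a : chart R X n) (x : X) :=
  curv (metric omega a) (coord a x).

Definition ricci_ge (c : R) : Prop :=
  forall a x, atlas M a -> dom a x -> forall u : 'rV[R[i]]_n,
    c * normsq (metric_at a x) u
      <= ricci_quad (metric_at a x) (curv_at a x) u.

Definition hol_sect_ge (c : R) : Prop :=
  forall a x, atlas M a -> dom a x -> forall u : 'rV[R[i]]_n, u != 0 ->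
    c <= hol_sect (metric_at a x) (curv_at a x) u.

Definition mu_rc_at (a : chart R X n) (x : X) : \bar R :=
  mu_rc (metric_at a x) (curv_at a x).

End Pointwise.

(* Main.v *)
Require Import Defs.
From mathcomp Require Import all_boot all_order all_algebra.
From mathcomp Require Import all_classical all_reals all_analysis.
From mathcomp Require Import spectral complex ring lra.
Import Order.TTheory GRing.Theory Num.Theory numFieldNormedType.Exports.
Local Open Scope classical_set_scope.
Local Open Scope ring_scope.

(* If Ric >= n + 1, take B = 1/n: the Kahler symmetries of the curvature give
   <R_B v, v> = Ric(v, v) / n.

   If H >= 2, subtract from R the tensor S_{ijkl} = g_{ij} g_{kl} + g_{il} g_{kj},
   whose holomorphic sectional curvature is 2.  The difference T has the same
   symmetries and T(u, u, u, u) >= 0.  For B = sum_p |w_p><w_p|, averaging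
   T(u, u, u, u) over u = sum_p th_p w_p with random phases th_p shows
   T(B, B) = sum_{p,q} T(w_p, w_p, w_q, w_q) >= 0, hence
   R(B, B) >= S(B, B) = (tr B)^2 + tr(B^2) >= 1 + 1/n when tr B = 1.
   If B minimises the quadratic form R(B, B) among densities, the first-order
   condition in the direction |v><v| reads <R_B v, v> >= R(B, B) for |v| = 1.
   An almost minimiser loses only an arbitrarily small error, which suffices for
   the supremum and avoids compactness.

   The symmetry R_{ijkl} = R_{kjil} combines d omega = 0 with the equality of
   mixed second derivatives. *)

Set Implicit Arguments.
Unset Strict Implicit.
Unset Printing Implicit Defensive.

(** * Equality of mixed partial derivatives *)

Section RealPartials.
Variables (R : realType) (n : nat).
Implicit Types (F : 'rV[R[i]]_n -> R) (u v z : 'rV[R[i]]_n).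

Definition line F v z (t : R) : R := F (z + (t%:C)%C *: v).

Definition partial F v z : R := derive1 (line F v z) 0.

(** Translating the parameter by t moves the base point along the line, so derivatives at 0 suffice
    to differentiate everywhere on it. *)
Lemma is_derive_line F v z t :
  derivable (line F v (z + (t%:C)%C *: v)) 0 1 ->
  is_derive t (1 : R) (line F v z) (partial F v (z + (t%:C)%C *: v)).
Proof.
move=> dF.
have -> : line F v z = line F v (z + (t%:C)%C *: v) \o (fun s => s - t).
  apply/funext => s /=; rewrite /line -addrA -scalerDl -rmorphD /=.
  by rewrite addrCA subrr addr0.
rewrite -[partial _ _ _]mulr1; apply: is_derive1_comp.
  rewrite subrr /partial derive1E; exact/derivableP.
have := is_deriveB (is_derive_id t (1 : R)) (is_derive_cst t t (1 : R)).
by rewrite subr0.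
Qed.

Lemma line_mvt F v z (d : R) : 0 < d ->
  (forall t : R, 0 <= t <= d -> derivable (line F v (z + (t%:C)%C *: v)) 0 1) ->
  exists2 t : R, 0 <= t <= d &
    F (z + (d%:C)%C *: v) - F z = d * partial F v (z + (t%:C)%C *: v).
Proof.
move=> d0 dF.
have dl t : 0 <= t <= d ->
    is_derive t (1 : R) (line F v z) (partial F v (z + (t%:C)%C *: v)).
  by move=> /dF; apply: is_derive_line.
have [| |t] :=
    @MVT R (line F v z) (fun t => partial F v (z + (t%:C)%C *: v)) 0 d d0.
- by move=> x; rewrite in_itv /= => /andP[x0 xd]; apply: dl; rewrite !ltW.
- apply: derivable_within_continuous => x; rewrite in_itv /= => /dl h.
  exact: ex_derive.
rewrite in_itv /= => /andP[t0 td] e; exists t; first by rewrite !ltW.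
by move: e; rewrite /line !scale0r addr0 subr0 mulrC.
Qed.

(** The mean value theorem is applied twice: in direction u to y |-> F (y + d v) - F y, then in
    direction v to the u-derivative of F. *)
Lemma second_difference F u v z (N : set 'rV[R[i]]_n) (d : R) : 0 < d ->
  (forall s t : R, 0 <= s <= d -> 0 <= t <= d ->
     N (z + (s%:C)%C *: u + (t%:C)%C *: v)) ->
  (forall y, N y -> derivable (line F u y) 0 1) ->
  (forall y, N y -> derivable (line (partial F u) v y) 0 1) ->
  exists2 y, N y &
    F (z + (d%:C)%C *: u + (d%:C)%C *: v) - F (z + (d%:C)%C *: u)
      - F (z + (d%:C)%C *: v) + F z
    = d * d * partial (partial F u) v y.
Proof.
move=> d0 box dFu dFuv.
have dd : 0 <= d <= d by rewrite (ltW d0) lexx.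
have d00 : 0 <= (0 : R) <= d by rewrite lexx ltW.
pose G y := F (y + (d%:C)%C *: v) - F y.
have lineG y : line G u y = line F u (y + (d%:C)%C *: v) - line F u y.
  by apply/funext => t; rewrite /line /G !fctE addrAC.
have dG s : 0 <= s <= d ->
    derivable (line G u (z + (s%:C)%C *: u)) 0 1 /\
    partial G u (z + (s%:C)%C *: u)
    = partial F u (z + (s%:C)%C *: u + (d%:C)%C *: v)
      - partial F u (z + (s%:C)%C *: u).
  move=> hs; have h1 := dFu _ (box s d hs dd); have h2 := dFu _ (box s 0 hs d00).
  move: h2; rewrite scale0r addr0 => h2.
  have [e1 e2] : is_derive (0 : R) (1 : R) (line G u (z + (s%:C)%C *: u))
      (partial F u (z + (s%:C)%C *: u + (d%:C)%C *: v)
       - partial F u (z + (s%:C)%C *: u)).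
    rewrite lineG /partial !derive1E.
    exact: is_deriveB (derivableP h1) (derivableP h2).
  by split; [exact: e1|rewrite {1}/partial derive1E e2].
have [s hs es] := @line_mvt G u z d d0 (fun s hs => (dG s hs).1).
have [|t ht et] := @line_mvt (partial F u) v (z + (s%:C)%C *: u) d d0.
  by move=> t ht; exact: dFuv _ (box s t hs ht).
exists (z + (s%:C)%C *: u + (t%:C)%C *: v); first exact: box.
move: es; rewrite (dG s hs).2 et mulrA => <-.
by rewrite /G opprB addrA [in RHS]addrAC.
Qed.

Lemma nbhs_box u v z (N : set 'rV[R[i]]_n) : nbhs z N ->
  exists2 d : R, 0 < d & forall s t : R, `|s| <= d -> `|t| <= d ->
    N (z + (s%:C)%C *: u + (t%:C)%C *: v).
Proof.
move=> /nbhs_normP[e /= e0 eN].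
(* The norm on complex row vectors takes values in [R[i]]; real parts bring the estimate back to
   [R]. *)
have nrm (w : 'rV[R[i]]_n) : `|w| = ((complex.Re `|w|)%:C)%C.
  by rewrite RRe_real // ger0_real.
have ge (w : 'rV[R[i]]_n) : 0 <= complex.Re `|w|.
  by rewrite -lecR -nrm; exact: (normr_ge0 w).
have e0' : 0 < complex.Re e by move: e0; rewrite ltcE => /andP[].
have eE : e = ((complex.Re e)%:C)%C by rewrite RRe_real // gtr0_real.
(* The summand 1 keeps K positive when u = v = 0 and makes the final inequality strict. *)
pose K := complex.Re `|u| + complex.Re `|v| + 1.
have K0 : 0 < K by rewrite ltr_wpDl // addr_ge0.
exists (complex.Re e / K); first by rewrite divr_gt0.
move=> s t sd td; apply: eN => /=.
rewrite -addrA opprD addNKr normrN.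
apply: (le_lt_trans (ler_normD _ _)).
rewrite !normrZ nrm (nrm v) !normc_def /= !expr0n /= !addr0 !sqrtr_sqr.
rewrite -!rmorphM -rmorphD /= eE ltcR.
rewrite (@le_lt_trans _ _ (complex.Re e / K * (complex.Re `|u| + complex.Re `|v|))) //.
  by rewrite mulrDr lerD // ler_wpM2r.
by rewrite mulrAC ltr_pdivrMr // ltr_pM2l // ltrDl.
Qed.

(** The second difference of F over a small parallelogram is symmetric in u and v. It equals d^2
    times either mixed derivative at some nearby point, and continuity carries the equality to z. *)
Lemma partial_commute F Fu Fv u v z :
  partial F u = Fu -> partial F v = Fv ->
  (\forall y \near z, derivable (line F u y) 0 1) ->
  (\forall y \near z, derivable (line F v y) 0 1) ->
  (\forall y \near z, derivable (line Fu v y) 0 1) ->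
  (\forall y \near z, derivable (line Fv u y) 0 1) ->
  {for z, continuous (partial Fu v)} ->
  {for z, continuous (partial Fv u)} ->
  partial Fu v z = partial Fv u z.
Proof.
move=> <- <- d1 d2 d3 d4 c1 c2; apply/eqP; rewrite -subr_eq0 -normr_le0.
apply/ler_addgt0Pl => e e0; rewrite addr0.
have e20 : 0 < e / 2 by rewrite divr_gt0.
have k1 : \forall y \near z,
    `|partial (partial F u) v z - partial (partial F u) v y| < e / 2.
  exact: (@cvgr_dist_lt _ _ _ _ _ _ _ c1 _ e20).
have k2 : \forall y \near z,
    `|partial (partial F v) u z - partial (partial F v) u y| < e / 2.
  exact: (@cvgr_dist_lt _ _ _ _ _ _ _ c2 _ e20).
have [N nN [N1 N2 N3 N4 [N5 N6]]] : exists2 N : set 'rV[R[i]]_n, nbhs z N &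
  [/\ forall y, N y -> derivable (line F u y) 0 1,
      forall y, N y -> derivable (line F v y) 0 1,
      forall y, N y -> derivable (line (partial F u) v y) 0 1,
      forall y, N y -> derivable (line (partial F v) u y) 0 1 &
      (forall y, N y ->
        `|partial (partial F u) v z - partial (partial F u) v y| < e / 2) /\
      (forall y, N y ->
        `|partial (partial F v) u z - partial (partial F v) u y| < e / 2)].
  have H := filterI (filterI d1 d2) (filterI (filterI d3 d4) (filterI k1 k2)).
  by eexists; first exact: H; split; [| | | |split] => y [[? ?] [[? ?] [? ?]]].
have [d d0 box'] := @nbhs_box u v z _ nN.
have box s t : 0 <= s <= d -> 0 <= t <= d ->
    N (z + (s%:C)%C *: u + (t%:C)%C *: v).
  by move=> /andP[s0 sd] /andP[t0 td]; apply: box'; rewrite ger0_norm.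
have [y Ny ey] := @second_difference F u v z N d d0 box N1 N3.
have [|y' Ny' ey'] := @second_difference F v u z N d d0 _ N2 N4.
  move=> s t hs ht; suff -> : z + (s%:C)%C *: v + (t%:C)%C *: u =
     z + (t%:C)%C *: u + (s%:C)%C *: v by apply: box.
  exact: addrAC.
have dn0 : d * d != 0 by rewrite mulf_neq0 // gt_eqF.
move: (N5 _ Ny) (N6 _ Ny') ey ey'.
rewrite [z + _ *: v + _ *: u]addrAC.
move: (partial _ v y) (partial _ u y') (partial _ v z) (partial _ u z).
move=> p p' q q' pe pe' ep ep'.
(* Both values are the same second difference divided by d^2. *)
have {ep ep'} pp : p = p'.
  by apply: (mulfI dn0); rewrite -ep -ep'; ring.
rewrite [e]splitr -(subrK p q) -addrA.
by rewrite (le_trans (ler_normD _ _)) // lerD // ltW // pp distrC.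
Qed.

End RealPartials.

(** * Complex-valued functions and commutation of d/dz with d/dzbar *)

Section ComplexPartials.
Variables (R : realType) (n : nat).
Implicit Types (f g : 'rV[R[i]]_n -> R[i]) (u v z : 'rV[R[i]]_n).

Lemma continuous_ReIm f z : {for z, continuous f} ->
  {for z, continuous (fun y => complex.Re (f y))} /\
  {for z, continuous (fun y => complex.Im (f y))}.
Proof.
have le_norm (x : R[i]) (e : R) : `|x| < (e%:C)%C ->
    `|complex.Re x| < e /\ `|complex.Im x| < e.
  rewrite normc_def ltcR => xe; split; apply: le_lt_trans xe.
    by rewrite -sqrtr_sqr ler_wsqrtr // lerDl sqr_ge0.
  by rewrite -sqrtr_sqr ler_wsqrtr // lerDr sqr_ge0.
move=> cf; split; apply: (iffRL (@cvgrPdist_lt _ _ _ _ (nbhs_filter z) _ _)) => e e0.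
  have e0' : 0 < (e%:C)%C by rewrite ltcR.
  have k : \forall y \near z, `|f z - f y| < (e%:C)%C.
    exact: (@cvgr_dist_lt _ _ _ _ _ _ _ cf _ e0').
  by apply: (@filterS _ _ (nbhs_filter z) _ _ _ k) => y /le_norm[+ _]; rewrite raddfB.
have e0' : 0 < (e%:C)%C by rewrite ltcR.
have k : \forall y \near z, `|f z - f y| < (e%:C)%C.
  exact: (@cvgr_dist_lt _ _ _ _ _ _ _ cf _ e0').
by apply: (@filterS _ _ (nbhs_filter z) _ _ _ k) => y /le_norm[_ +]; rewrite raddfB.
Qed.

Lemma partial_Re f v : partial (fun y => complex.Re (f y)) v
  = (fun y => complex.Re (rderive f v y)).
Proof. by []. Qed.

Lemma partial_Im f v : partial (fun y => complex.Im (f y)) v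
  = (fun y => complex.Im (rderive f v y)).
Proof. by []. Qed.

Lemma continuous_partial_ReIm f v z : {for z, continuous (rderive f v)} ->
  {for z, continuous (partial (fun y => complex.Re (f y)) v)} /\
  {for z, continuous (partial (fun y => complex.Im (f y)) v)}.
Proof. exact: continuous_ReIm. Qed.

Lemma near_derivable_line (D : set 'rV[R[i]]_n) f v z : nbhs z D ->
  (forall y, D y -> rderivable f v y) ->
  (\forall y \near z, derivable (line (fun y => complex.Re (f y)) v y) 0 1) /\
  (\forall y \near z, derivable (line (fun y => complex.Im (f y)) v y) 0 1).
Proof.
move=> nD df; split; apply: filterS nD => y Dy.
  exact: (df y Dy).1.
exact: (df y Dy).2.
Qed.

Lemma rderive_commute (D : set 'rV[R[i]]_n) f u v z : open D -> D z -> Ck 2 D f ->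
  rderive (rderive f u) v z = rderive (rderive f v) u z.
Proof.
move=> oD Dz [_ C2].
have nD : nbhs z D by apply: open_nbhs_nbhs.
have [du [_ du2]] := C2 u; have [dv [_ dv2]] := C2 v.
have [duv cuv] := du2 v; have [dvu cvu] := dv2 u.
have [c1 c2] := continuous_partial_ReIm (cuv.1 z Dz).
have [c3 c4] := continuous_partial_ReIm (cvu.1 z Dz).
have [a1 b1] := near_derivable_line nD du.
have [a2 b2] := near_derivable_line nD dv.
have [a3 b3] := near_derivable_line nD duv.
have [a4 b4] := near_derivable_line nD dvu.
have eRe := partial_commute (partial_Re f u) (partial_Re f v) a1 a2 a3 a4 c1 c3.
have eIm := partial_commute (partial_Im f u) (partial_Im f v) b1 b2 b3 b4 c2 c4.
exact: (f_equal2 (@Complex R) eRe eIm).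
Qed.

Lemma near_rderive f g v z : (\forall y \near z, f y = g y) ->
  rderive f v z = rderive g v z.
Proof.
(* The second direction is 0, so the parallelogram degenerates to a segment along v. *)
move=> fg; have [d d0 box] := @nbhs_box R n v 0 z _ fg.
have nl : \forall t \near (0 : R),
    f (z + (t%:C)%C *: v) = g (z + (t%:C)%C *: v).
  apply/nbhs_normP; exists d => //= t; rewrite /= sub0r normrN => td.
  have := box t 0 (ltW td); rewrite scaler0 addr0; apply.
  by rewrite normr0 ltW.
rewrite /rderive; congr Complex; rewrite !derive1E; apply: near_eq_derive;
  by apply: filterS nl => t; rewrite /line_re /line_im => ->.
Qed.

Lemma Re_comb (a b x y : R[i]) : complex.Re (a * x + b * y)
  = complex.Re a * complex.Re x - complex.Im a * complex.Im x
    + (complex.Re b * complex.Re y - complex.Im b * complex.Im y).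
Proof. by case: a x b y => [? ?] [? ?] [? ?] [? ?]. Qed.

Lemma Im_comb (a b x y : R[i]) : complex.Im (a * x + b * y)
  = complex.Re a * complex.Im x + complex.Im a * complex.Re x
    + (complex.Re b * complex.Im y + complex.Im b * complex.Re y).
Proof. by case: a x b y => [? ?] [? ?] [? ?] [? ?]. Qed.

(** Although only real-linear in the direction, [rderive] is complex-linear in the function; this
    expands iterated d/dz and d/dzbar. *)
Lemma rderive_comb (a b : R[i]) f g v z : rderivable f v z ->
  rderivable g v z ->
  rderive (fun y => a * f y + b * g y) v z
  = a * rderive f v z + b * rderive g v z.
Proof.
move=> [/derivableP f1 /derivableP f2] [/derivableP g1 /derivableP g2].
have re : line_re (fun y => a * f y + b * g y) v z
   = (complex.Re a \*: line_re f v z - complex.Im a \*: line_im f v z)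
     + (complex.Re b \*: line_re g v z - complex.Im b \*: line_im g v z).
  by apply/funext => t; exact: Re_comb.
have im : line_im (fun y => a * f y + b * g y) v z
   = (complex.Re a \*: line_im f v z + complex.Im a \*: line_re f v z)
     + (complex.Re b \*: line_im g v z + complex.Im b \*: line_re g v z).
  by apply/funext => t; exact: Im_comb.
have [_ dre] := is_deriveD
  (is_deriveB (is_deriveZ (complex.Re a) f1) (is_deriveZ (complex.Im a) f2))
  (is_deriveB (is_deriveZ (complex.Re b) g1) (is_deriveZ (complex.Im b) g2)).
have [_ dim] := is_deriveD
  (is_deriveD (is_deriveZ (complex.Re a) f2) (is_deriveZ (complex.Im a) f1))
  (is_deriveD (is_deriveZ (complex.Re b) g2) (is_deriveZ (complex.Im b) g1)).
rewrite /rderive re im !derive1E dre dim [RHS]complexE Re_comb Im_comb.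
exact: complexE.
Qed.

Local Notation e := (@basis_vec R n).

Lemma dzE i f : dz i f = (fun y => 2%:R^-1 * rderive f (e i) y
   + (- 'i%C / 2%:R) * rderive f ('i%C *: e i) y).
Proof.
apply/funext => y; rewrite /dz.
by move: (rderive f _ y) (rderive f ('i%C *: _) y) => p q; ring.
Qed.

Lemma dzbarE i f : dzbar i f = (fun y => 2%:R^-1 * rderive f (e i) y
   + ('i%C / 2%:R) * rderive f ('i%C *: e i) y).
Proof.
apply/funext => y; rewrite /dzbar.
by move: (rderive f _ y) (rderive f ('i%C *: _) y) => p q; ring.
Qed.

(** Both sides expand into the same combination of four second real derivatives, up to the order of
    differentiation. *)
Lemma dz_dzbar (D : set 'rV[R[i]]_n) f i j z : open D -> D z -> Ck 2 D f ->
  dz i (dzbar j f) z = dzbar j (dz i f) z.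
Proof.
move=> oD Dz Cf.
have dr u v : rderivable (rderive f u) v z by exact: ((Cf.2 u).2.2 v).1.
have c u v : rderive (rderive f u) v z = rderive (rderive f v) u z.
  exact: rderive_commute oD Dz Cf.
have L : dz i (dzbar j f) z =
    2%:R^-1 * (2%:R^-1 * rderive (rderive f (e j)) (e i) z
      + 'i%C / 2%:R * rderive (rderive f ('i%C *: e j)) (e i) z)
    + (- 'i%C / 2%:R) *
      (2%:R^-1 * rderive (rderive f (e j)) ('i%C *: e i) z
      + 'i%C / 2%:R
        * rderive (rderive f ('i%C *: e j)) ('i%C *: e i) z).
  rewrite dzE dzbarE; congr (_ * _ + _ * _);
    exact: (rderive_comb _ _ (dr _ _) (dr _ _)).
have L' : dzbar j (dz i f) z =
    2%:R^-1 * (2%:R^-1 * rderive (rderive f (e i)) (e j) z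
      + (- 'i%C / 2%:R)
        * rderive (rderive f ('i%C *: e i)) (e j) z)
    + 'i%C / 2%:R *
      (2%:R^-1 * rderive (rderive f (e i)) ('i%C *: e j) z
      + (- 'i%C / 2%:R)
        * rderive (rderive f ('i%C *: e i)) ('i%C *: e j) z).
  rewrite dzbarE dzE; congr (_ * _ + _ * _);
    exact: (rderive_comb _ _ (dr _ _) (dr _ _)).
have alg (p q r s p' q' r' s' : R[i]) : p = p' -> q = q' -> r = r' -> s = s' ->
    2%:R^-1 * (2%:R^-1 * p + 'i%C / 2%:R * q)
    + (- 'i%C / 2%:R) * (2%:R^-1 * r + 'i%C / 2%:R * s)
    = 2%:R^-1 * (2%:R^-1 * p' + (- 'i%C / 2%:R) * r')
    + 'i%C / 2%:R * (2%:R^-1 * q' + (- 'i%C / 2%:R) * s').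
  by move=> -> -> -> ->; ring.
by rewrite L L'; exact: (alg _ _ _ _ _ _ _ _ (c _ _) (c _ _) (c _ _) (c _ _)).
Qed.

Lemma near_dz i f g z : (\forall y \near z, f y = g y) -> dz i f z = dz i g z.
Proof. by move=> fg; rewrite /dz !(near_rderive _ fg). Qed.

Lemma near_dzbar i f g z : (\forall y \near z, f y = g y) ->
  dzbar i f z = dzbar i g z.
Proof. by move=> fg; rewrite /dzbar !(near_rderive _ fg). Qed.

End ComplexPartials.

(** * Symmetries of the curvature *)

Section CurvSymmetry.
Variables (R : realType) (n : nat).
Variables (D : set 'rV[R[i]]_n) (g : 'rV[R[i]]_n -> 'M[R[i]]_n).
Hypotheses (openD : open D)
  (smooth_g : forall i j, smooth D (fun z => g z i j))
  (closed_g : forall z, D z -> forall i j k,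
    dz k (fun y => g y i j) z = dz i (fun y => g y k j) z)
  (closed_bar_g : forall z, D z -> forall i j k,
    dzbar k (fun y => g y i j) z = dzbar j (fun y => g y i k) z).
Variables (z : 'rV[R[i]]_n) (Dz : D z).

(** Closedness exchanges i and k under d/dz, which must first be moved inside d/dzbar in the
    second-order term. *)
Lemma curv_swap13 i j k l : curv g z i j k l = curv g z k j i l.
Proof.
have nD : nbhs z D by apply: open_nbhs_nbhs.
have com a b c e : dz a (dzbar b (fun y => g y c e)) z
    = dzbar b (dz a (fun y => g y c e)) z.
  exact: (dz_dzbar a b openD Dz (@smooth_g c e 2)).
have first_term : dz i (dzbar j (fun y => g y k l)) z
    = dz k (dzbar j (fun y => g y i l)) z.
  apply: (etrans (com _ _ _ _)); apply: (etrans _ (esym (com _ _ _ _))).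
  by apply: near_dzbar; apply: filterS nD => y Dy; exact: (closed_g Dy).
apply: (f_equal2 (fun s t => - s + t) first_term).
apply: eq_bigr => p _; apply: eq_bigr => q _.
exact: (f_equal (fun c => _ * c * _) (closed_g Dz k q i)).
Qed.

(** Here d/dzbar is already the inner derivative, so closedness applies directly. *)
Lemma curv_swap24 i j k l : curv g z i j k l = curv g z i l k j.
Proof.
have nD : nbhs z D by apply: open_nbhs_nbhs.
have first_term : dz i (dzbar j (fun y => g y k l)) z
    = dz i (dzbar l (fun y => g y k j)) z.
  by apply: near_dz; apply: filterS nD => y Dy; exact: (closed_bar_g Dy).
apply: (f_equal2 (fun s t => - s + t) first_term).
apply: eq_bigr => p _; apply: eq_bigr => q _.
exact: (f_equal (fun c => _ * c) (closed_bar_g Dz p l j)).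
Qed.

End CurvSymmetry.

(** * Phase averaging and almost minimisers *)

Section PhaseAveraging.
Variables (R : realType) (V : lmodType R[i]) (t : V -> V -> R).

(** Four times the average of f (x + th y) over the fourth roots of unity th. *)
Definition phase_sum (f : V -> R) (x y : V) : R :=
  f (x + y) + f (x + 'i%C *: y) + f (x - y) + f (x - 'i%C *: y).

(** The value t(B, B) at B = sum_p |w_p><w_p|; densities are represented by finite lists of
    vectors. *)
Definition pair_sum (ws : seq V) : R := \sum_(p <- ws) \sum_(q <- ws) t p q.

Hypotheses (t_sym : forall x y, t x y = t y x)
  (t_phase : forall x y z, phase_sum (t^~ z) x y = 4 * (t x z + t y z))
  (t_phase_diag : forall x y,
     phase_sum (fun u => t u u) x y = 4 * (t x x + t y y + 4 * t x y))
  (t_diag_ge0 : forall x, 0 <= t x x).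

Lemma pair_sum_cons y ws :
  pair_sum (y :: ws) = t y y + 2 * (\sum_(p <- ws) t y p) + pair_sum ws.
Proof.
rewrite /pair_sum !big_cons.
under [X in _ + X = _]eq_bigr => p _ do rewrite big_cons t_sym.
rewrite big_split /=; ring.
Qed.

(* For unit complex numbers th_p independent and uniform among the fourth roots
   of unity, this is the expectation of t(x, x) at x = u + sum_p th_p w_p. *)
Lemma phase_expectation_ge0 ws u :
  0 <= t u u + 4 * (\sum_(p <- ws) t u p) + 2 * pair_sum ws
       - \sum_(p <- ws) t p p.
Proof.
elim: ws u => [|y ws IH] u.
  by rewrite /pair_sum !big_nil !mulr0 !addr0 subr0.
rewrite pair_sum_cons !big_cons.
(* Averaging the induction hypothesis over u + th y, with th a fourth root of unity, gives the claim
   for y :: ws. *)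
have := addr_ge0 (addr_ge0 (addr_ge0 (IH (u + y)) (IH (u + 'i%C *: y)))
  (IH (u - y))) (IH (u - 'i%C *: y)).
have := t_phase_diag u y; rewrite /phase_sum => diag.
have : phase_sum (fun x => \sum_(p <- ws) t x p) u y
    = 4 * (\sum_(p <- ws) t u p + \sum_(p <- ws) t y p).
  rewrite /phase_sum -!big_split /= mulr_sumr; apply: eq_bigr => p _.
  exact: t_phase.
rewrite /phase_sum; lra.
Qed.

(** At u = 0 the expectation gives 2 t(B, B) >= sum_p t(p, p) >= 0. *)
Lemma pair_sum_ge0 ws : 0 <= pair_sum ws.
Proof.
(* At the zero vectors, the phase identity reads 4 t(0, x) = 8 t(0, x). *)
have t0 x : t 0 x = 0.
  by have := t_phase 0 0 x; rewrite /phase_sum scaler0 subr0 addr0; lra.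
have := phase_expectation_ge0 ws 0; rewrite t0 big1 => [|p _]; last exact: t0.
have : 0 <= \sum_(p <- ws) t p p by apply: sumr_ge0.
lra.
Qed.

End PhaseAveraging.

Section NearMinimiser.
Variables (R : realType) (V : lmodType R[i]) (s : V -> V -> R) (h : V -> R).
Hypotheses (s_sym : forall x y, s x y = s y x)
  (s_scale : forall (a : R) x y, s ((a%:C)%C *: x) y = a ^+ 2 * s x y)
  (h_scale : forall (a : R) x, h ((a%:C)%C *: x) = a ^+ 2 * h x).

Let density ws := \sum_(p <- ws) h p = 1.

Lemma pair_sum_scale a ws :
  pair_sum s [seq (a%:C)%C *: p | p <- ws] = a ^+ 4 * pair_sum s ws.
Proof.
rewrite /pair_sum big_map mulr_sumr; apply: eq_bigr => p _.
rewrite big_map mulr_sumr; apply: eq_bigr => q _.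
rewrite s_scale s_sym s_scale (s_sym q); ring.
Qed.

(* First-order condition at an almost minimiser [ws] of the quadratic form
   [pair_sum s] on densities: move to (1 - e) ws + e v. *)
Lemma near_minimiser (c K eps : R) : 0 <= c -> 0 <= K -> 0 < eps ->
  (exists v, h v = 1) ->
  (forall v, h v = 1 -> s v v <= K) ->
  (forall ws, density ws -> c <= pair_sum s ws) ->
  exists2 ws, density ws &
    forall v, h v = 1 -> c - eps <= \sum_(p <- ws) s p v.
Proof.
move=> c0 K0 eps0 [v0 hv0] sK sc.
pose E := [set pair_sum s ws | ws in [set ws | density ws]].
have hasE : has_inf E.
  split; first by exists (pair_sum s [:: v0]), [:: v0] => //=;
    rewrite /density big_seq1.
  by exists c => _ [ws dws <-]; exact: sc.
pose m := inf E.
have cm : c <= m.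
  by apply: lb_le_inf; [exact: hasE.1|move=> _ [ws dws <-]; exact: sc].
(* This e solves e (K + 1 + 2 eps) = eps, which is what the final contradiction requires. *)
pose e := eps / (K + 1 + 2 * eps).
have den0 : 0 < K + 1 + 2 * eps by lra.
have e0 : 0 < e by rewrite divr_gt0.
have eE : e * (K + 1 + 2 * eps) = eps by rewrite mulfVK // gt_eqF.
have e1 : e < 1 by rewrite ltr_pdivrMr //; lra.
(* The gap to the infimum is below e^2, hence of second order in the step e. *)
have [_ [ws dws <-] wsm] := inf_adherent (exprn_gt0 2 e0) hasE.
exists ws => // v hv.
(* Square roots appear because a vector enters its density quadratically: the weights become e and 1
   - e. *)
pose ws' := ((Num.sqrt e)%:C)%C *: v ::
  [seq ((Num.sqrt (1 - e))%:C)%C *: p | p <- ws].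
have dws' : density ws'.
  rewrite /density big_cons big_map h_scale hv.
  under eq_bigr do rewrite h_scale.
  by rewrite -mulr_sumr dws !sqr_sqrtr ?subr_ge0 ?(ltW e0) ?(ltW e1) // !mulr1 addrC
    subrK.
have := ge_inf hasE.2 (ex_intro2 _ _ ws' dws' erefl).
rewrite -/m pair_sum_cons // pair_sum_scale big_map.
under eq_bigr do rewrite s_scale s_sym s_scale.
rewrite -!mulr_sumr s_scale s_sym s_scale.
have -> : Num.sqrt (1 - e) ^+ 4 = (1 - e) ^+ 2.
  by rewrite (exprM _ 2 2) sqr_sqrtr // subr_ge0 ltW.
rewrite !sqr_sqrtr ?subr_ge0 ?(ltW e0) ?(ltW e1) //.
set L := \sum_(p <- ws) _.
have := sK v hv; move: wsm; rewrite -/m.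
move: (pair_sum s ws) (s v v) => N k Nm kK ineq.
rewrite leNgt; apply/negP => Lc.
have p1 : 0 < e * (1 - e) by rewrite mulr_gt0 // subr_gt0.
have i1 : e * (1 - e) * L < e * (1 - e) * (m - eps) by rewrite ltr_pM2l //; lra.
have i2 : (1 - e) ^+ 2 * N <= (1 - e) ^+ 2 * m + e ^+ 2.
  have : (1 - e) ^+ 2 * N <= (1 - e) ^+ 2 * (m + e ^+ 2).
    by rewrite ler_wpM2l ?sqr_ge0 ?ltW.
  have : (1 - e) ^+ 2 * e ^+ 2 <= 1 * e ^+ 2.
    by rewrite ler_wpM2r ?sqr_ge0 // expr_le1 ?subr_ge0 ?(ltW e1) // gerBl ltW.
  lra.
have i3 : e ^+ 2 * k <= e ^+ 2 * K by rewrite ler_wpM2l ?sqr_ge0.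
have i4 : e * (e * (K + 1 + 2 * eps)) = e * eps by rewrite eE.
have i5 : 0 < e * eps by rewrite mulr_gt0.
have i6 : 0 <= e ^+ 2 * m by rewrite mulr_ge0 ?sqr_ge0 //; lra.
(* If L < c - eps <= m - eps, the bounds combine to e^2 m < e^2 (K + 1 + 2 eps) - 2 e eps = - e eps
   < 0, against m >= 0. *)
nra.
Qed.

End NearMinimiser.

(** * Averages over the fourth roots of unity *)

Section PhaseAlgebra.
Variables (R : realType) (V : lmodType R[i]).

Lemma phase_sumE (f : V -> R) x y : phase_sum f x y
  = f (x + 1 *: y) + f (x + 'i%C *: y) + f (x + (- 1) *: y)
    + f (x + (- 'i%C) *: y).
Proof. by rewrite /phase_sum scaleN1r scaleNr scale1r. Qed.

Lemma conjc_i : ('i^*)%C = - 'i%C :> R[i].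
Proof. by simpc. Qed.

Lemma conjcN (a : R[i]) : ((- a)^*)%C = - (a^*)%C.
Proof. exact: rmorphN. Qed.

Lemma phase_norm (a : R[i]) : a \in [:: 1; 'i%C; -1; - 'i%C] -> a * (a^*)%C = 1.
Proof.
rewrite !inE => /or4P[] /eqP->; rewrite ?conjcN ?conjc1 ?conjc_i.
- by rewrite mulr1.
- by rewrite mulrN -expr2 sqr_i opprK.
- by rewrite mulrNN mulr1.
- by rewrite mulrNN mulrN -expr2 sqr_i opprK.
Qed.

(** The sums of a, its conjugate and their squares over the fourth roots of unity vanish, so only
    the constant term survives. *)
Lemma Re_phase_sum (f : V -> R) (A E F G H : R[i]) x y :
  (forall a, a * (a^*)%C = 1 -> f (x + a *: y) = complex.Re
     (A + a * E + (a^*)%C * F + a ^+ 2 * G + (a^*)%C ^+ 2 * H)) ->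
  phase_sum f x y = complex.Re (4 * A).
Proof.
move=> fE; rewrite phase_sumE !fE; try by apply: phase_norm; rewrite !inE eqxx ?orbT.
rewrite -!raddfD; congr complex.Re.
rewrite !conjcN conjc1 conjc_i !sqrrN sqr_i expr1n.
ring.
Qed.

Lemma Re_mul4 (x : R[i]) : complex.Re (4 * x) = 4 * complex.Re x.
Proof. by rewrite !mulr_natl raddfMn. Qed.

End PhaseAlgebra.

(** * Multilinearity and symmetries of the curvature form *)

Section Curv4.
Variables (R : realType) (n : nat).
Implicit Types (Rm : 'I_n -> 'I_n -> 'I_n -> 'I_n -> R[i]).
Implicit Types (G : 'M[R[i]]_n) (u v w s x y z : 'rV[R[i]]_n).

(** With a single sum over quadruples, permuting arguments becomes a reindexing. *)
Lemma curv4E Rm u v w s : curv4 Rm u v w s =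
  \sum_(q : 'I_n * 'I_n * 'I_n * 'I_n) Rm q.1.1.1 q.1.1.2 q.1.2 q.2
    * u 0 q.1.1.1 * ((v 0 q.1.1.2)^*)%C * w 0 q.1.2 * ((s 0 q.2)^*)%C.
Proof. by rewrite /curv4 pair_bigA /= pair_bigA /= pair_bigA. Qed.

Lemma curv4_swap13 Rm u v w s :
  curv4 (fun i j k l => Rm k j i l) u v w s = curv4 Rm w v u s.
Proof.
rewrite !curv4E (reindex_inj (inv_inj
  (f := fun q => (q.1.2, q.1.1.2, q.1.1.1, q.2)) _)) /=.
  by apply: eq_bigr => q _; ring.
by move=> [[[i j] k] l].
Qed.

Lemma curv4_swap24 Rm u v w s :
  curv4 (fun i j k l => Rm i l k j) u v w s = curv4 Rm u s w v.
Proof.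
rewrite !curv4E (reindex_inj (inv_inj
  (f := fun q => (q.1.1.1, q.2, q.1.2, q.1.1.2)) _)) /=.
  by apply: eq_bigr => q _; ring.
by move=> [[[i j] k] l].
Qed.

Lemma eq_curv4 Rm Rm' u v w s : (forall i j k l, Rm i j k l = Rm' i j k l) ->
  curv4 Rm u v w s = curv4 Rm' u v w s.
Proof. by move=> e; rewrite !curv4E; apply: eq_bigr => q _; rewrite e. Qed.

Lemma curv4B Rm Rm' u v w s :
  curv4 (fun i j k l => Rm i j k l - Rm' i j k l) u v w s
  = curv4 Rm u v w s - curv4 Rm' u v w s.
Proof. by rewrite !curv4E -sumrB; apply: eq_bigr => q _; ring. Qed.

Lemma curv4_lin1 Rm a u u' v w s :
  curv4 Rm (u + a *: u') v w s = curv4 Rm u v w s + a * curv4 Rm u' v w s.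
Proof.
rewrite !curv4E mulr_sumr -big_split /=; apply: eq_bigr => q _.
by rewrite !mxE; ring.
Qed.

Lemma curv4_lin2 Rm a u v v' w s :
  curv4 Rm u (v + a *: v') w s
  = curv4 Rm u v w s + (a^*)%C * curv4 Rm u v' w s.
Proof.
rewrite !curv4E mulr_sumr -big_split /=; apply: eq_bigr => q _.
by rewrite !mxE rmorphD rmorphM /=; ring.
Qed.

Lemma curv4_lin3 Rm a u v w w' s :
  curv4 Rm u v (w + a *: w') s = curv4 Rm u v w s + a * curv4 Rm u v w' s.
Proof. by rewrite -!(curv4_swap13 Rm) -curv4_lin1. Qed.

Lemma curv4_lin4 Rm a u v w s s' :
  curv4 Rm u v w (s + a *: s')
  = curv4 Rm u v w s + (a^*)%C * curv4 Rm u v w s'.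
Proof. by rewrite -!(curv4_swap24 Rm) -curv4_lin2. Qed.

Section Symmetric.
Variable Rm : 'I_n -> 'I_n -> 'I_n -> 'I_n -> R[i].
Hypotheses (Rm13 : forall i j k l, Rm i j k l = Rm k j i l)
  (Rm24 : forall i j k l, Rm i j k l = Rm i l k j).

Lemma curv4_sym13 u v w s : curv4 Rm u v w s = curv4 Rm w v u s.
Proof. by rewrite -curv4_swap13; apply: eq_curv4. Qed.

Lemma curv4_sym24 u v w s : curv4 Rm u v w s = curv4 Rm u s w v.
Proof. by rewrite -curv4_swap24; apply: eq_curv4. Qed.

(** The curvature paired with |x><x| and |y><y|. *)
Definition biquad x y : R := complex.Re (curv4 Rm x x y y).

Lemma biquad_sym x y : biquad x y = biquad y x.
Proof. by rewrite /biquad curv4_sym13 curv4_sym24. Qed.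

Lemma biquad_scale (a : R) x y : biquad ((a%:C)%C *: x) y = a ^+ 2 * biquad x y.
Proof.
have c0 v w s : curv4 Rm 0 v w s = 0.
  by rewrite curv4E big1 // => q _; rewrite mxE; ring.
have c0' u w s : curv4 Rm u 0 w s = 0.
  by rewrite curv4E big1 // => q _; rewrite mxE conjc0; ring.
rewrite /biquad -[(a%:C)%C *: x]add0r curv4_lin1 !curv4_lin2 !c0 !c0' conjc_real.
by case: (curv4 Rm x x y y) => p q; rewrite !add0r /=; simpc; rewrite /= mulrA expr2.
Qed.

(** The zero terms fit the expansion to the shape required by [Re_phase_sum]. *)
Lemma curv4_phase a x y z : a * (a^*)%C = 1 ->
  curv4 Rm (x + a *: y) (x + a *: y) z z
  = curv4 Rm x x z z + curv4 Rm y y z z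
    + a * curv4 Rm y x z z + (a^*)%C * curv4 Rm x y z z
    + a ^+ 2 * 0 + (a^*)%C ^+ 2 * 0.
Proof.
set b := (a^*)%C => ab.
rewrite curv4_lin1 !curv4_lin2 -/b.
move: (curv4 Rm x x z z) (curv4 Rm x y z z) (curv4 Rm y x z z) (curv4 Rm y y z z).
move=> p q r s.
by rewrite [RHS](_ : _ = p + a * b * s + a * r + b * q); [ring|rewrite ab; ring].
Qed.

(** The coefficient 4 counts the placements of one y in a linear and one in a conjugate-linear slot;
    the symmetries identify all four terms. *)
Lemma curv4_phase_diag a x y : a * (a^*)%C = 1 ->
  curv4 Rm (x + a *: y) (x + a *: y) (x + a *: y) (x + a *: y)
  = curv4 Rm x x x x + curv4 Rm y y y y + 4 * curv4 Rm x x y y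
    + a * (2 * curv4 Rm y x x x + 2 * curv4 Rm y y y x)
    + (a^*)%C * (2 * curv4 Rm x y x x + 2 * curv4 Rm x y y y)
    + a ^+ 2 * curv4 Rm y x y x + (a^*)%C ^+ 2 * curv4 Rm x y x y.
Proof.
set b := (a^*)%C => ab.
rewrite curv4_lin1 !curv4_lin2 !curv4_lin3 !curv4_lin4 -/b.
rewrite (curv4_sym13 y x x y) (curv4_sym13 y y x x) (curv4_sym24 x y y x).
rewrite (curv4_sym24 x x x y) (curv4_sym13 x x y x).
rewrite (curv4_sym13 y y x y) (curv4_sym24 y x y y).
move: (curv4 Rm x x x x) (curv4 Rm y y y y) (curv4 Rm x x y y) => p q r.
move: (curv4 Rm y x x x) (curv4 Rm y y y x) (curv4 Rm x y x x) (curv4 Rm x y y y).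
move: (curv4 Rm y x y x) (curv4 Rm x y x y) => g h e1 e2 f1 f2.
(* Keeping the factors a b explicit leaves a polynomial identity; a b = 1 is used only
   afterwards. *)
transitivity (p + (a * b) ^+ 2 * q + 4 * (a * b) * r
    + a * (2 * e1 + 2 * (a * b) * e2) + b * (2 * f1 + 2 * (a * b) * f2)
    + a ^+ 2 * g + b ^+ 2 * h); first by ring.
by rewrite ab; ring.
Qed.

Lemma biquad_phase x y z :
  phase_sum (biquad^~ z) x y = 4 * (biquad x z + biquad y z).
Proof.
rewrite (Re_phase_sum (fun a ha => f_equal (@complex.Re R) (curv4_phase x y z ha))).
by rewrite Re_mul4 raddfD.
Qed.

Lemma biquad_phase_diag x y :
  phase_sum (fun u => biquad u u) x y
  = 4 * (biquad x x + biquad y y + 4 * biquad x y).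
Proof.
rewrite (Re_phase_sum (fun a ha => f_equal (@complex.Re R) (curv4_phase_diag x y ha))).
by rewrite Re_mul4 !raddfD [X in _ + X]Re_mul4.
Qed.

End Symmetric.
End Curv4.

(** * Hermitian metrics and densities *)

Section HermitianMetric.
Variables (R : realType) (n : nat) (G : 'M[R[i]]_n).
Hypothesis posG : hermitian_posdef G.
Implicit Types (u v w x y : 'rV[R[i]]_n) (ws : seq 'rV[R[i]]_n).

Lemma herm_conj u v : herm G v u = ((herm G u v)^*)%C.
Proof.
rewrite /herm rmorph_sum /= exchange_big; apply: eq_bigr => i _ /=.
rewrite rmorph_sum /=; apply: eq_bigr => j _.
by rewrite !rmorphM /= conjcK (posG.1 i j); ring.
Qed.

Lemma herm_diag u : herm G u u = ((normsq G u)%:C)%C.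
Proof.
have := herm_conj u u; rewrite /normsq; case: (herm G u u) => a b [] bN.
by congr Complex; lra.
Qed.

Lemma normsq_gt0 u : u != 0 -> 0 < normsq G u.
Proof. by move=> /(posG.2 u); rewrite herm_diag ltcR. Qed.

Lemma herm0l u : herm G 0 u = 0.
Proof. by rewrite herm_mx !mul0mx mxE. Qed.

Lemma normsq0 : normsq G 0 = 0.
Proof. by rewrite /normsq herm0l. Qed.

Lemma normsq_ge0 u : 0 <= normsq G u.
Proof.
by have [->|/normsq_gt0/ltW //] := eqVneq u 0; rewrite normsq0.
Qed.

Lemma normsq_scale (a : R) u : normsq G ((a%:C)%C *: u) = a ^+ 2 * normsq G u.
Proof.
rewrite /normsq !herm_mx -!scalemxAl map_mxZ linearZ /= -scalemxAr.
rewrite [X in complex.Re X]mxE [X in complex.Re (_ * X)]mxE /= oppr0.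
move: ((u *m G *m _) 0 0) => [p q].
by simpc; rewrite /= mulrA expr2.
Qed.

(** By the spectral theorem G = U^-1 diag(d) U with U unitary, and d_a > 0 is the value of the form
    on row a of U; take P = U^-1 diag(sqrt d). *)
Lemma posdef_gram : exists2 P : 'M[R[i]]_n, P \in unitmx &
  G = P *m (map_mx (@conjc R) P)^T.
Proof.
have Gherm : G \is hermsymmx.
  apply/is_hermitianmxP; rewrite expr0 scale1r; apply/matrixP => i j.
  by rewrite !mxE; exact: posG.1.
have := orthomx_spectralP (hermitian_normalmx Gherm).
set U := spectralmx G; set d := spectral_diag G => GE.
have Uunit : U \in unitmx by exact: spectral_unit.
have invU : invmx U = (map_mx (@conjc R) U)^T.
  by rewrite invmx_unitary ?spectral_unitarymx // map_trmx.
have d_gt0 a : 0 < d 0 a.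
  have <- : herm G (row a U) (row a U) = d 0 a.
    have -> : herm G (row a U) (row a U) = (U *m G *m invmx U) a a.
      rewrite herm_mx invU -!row_mul !mxE; apply: eq_bigr => j _.
      by rewrite !mxE.
    by rewrite GE !mulmxA mulmxV // mul1mx mulmxK // !mxE eqxx mulr1n.
  apply: posG.2; apply/eqP => U0.
  have : (U *m invmx U) a a = 0.
    rewrite mxE big1 // => j _; move/rowP: U0 => /(_ j); rewrite !mxE => ->.
    by rewrite mul0r.
  by rewrite mulmxV // mxE eqxx => /eqP; rewrite oner_eq0.
pose r := map_mx (fun c : R[i] => sqrtC c) d.
exists (invmx U *m diag_mx r).
  rewrite unitmx_mul unitmx_inv Uunit unitmxE det_diag unitfE.
  apply/prodf_neq0 => a _; rewrite mxE sqrtC_eq0.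
  by rewrite gt_eqF.
have -> : (map_mx (@conjc R) (invmx U *m diag_mx r))^T = diag_mx r *m U.
  rewrite map_mxM trmx_mul map_diag_mx tr_diag_mx.
  congr (diag_mx _ *m _); last first.
    by rewrite invU; apply/matrixP => a b; rewrite !mxE; exact: conjcK.
  apply/rowP => a; rewrite !mxE; apply: geC0_conj.
  by rewrite sqrtC_ge0 ltW.
rewrite mulmxA -[_ *m diag_mx r *m diag_mx r]mulmxA mulmx_diag.
apply: etrans GE _; congr (_ *m diag_mx _ *m _).
by apply/rowP => a; rewrite !mxE -expr2 sqrtCK.
Qed.

Lemma posdef_unit : G \in unitmx.
Proof.
have [P uP ->] := posdef_gram.
by rewrite unitmx_mul unitmx_tr map_unitmx uP.
Qed.

End HermitianMetric.

(** * Densities as sums of rank-one endomorphisms *)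

Section Densities.
Variables (R : realType) (n : nat) (G : 'M[R[i]]_n).
Hypothesis posG : hermitian_posdef G.
Variable Rm : 'I_n -> 'I_n -> 'I_n -> 'I_n -> R[i].
Implicit Types (u v w x y : 'rV[R[i]]_n) (ws : seq 'rV[R[i]]_n).

(* The endomorphism [u |-> sum_w <u, w> w]. *)
Definition rank_one_sum ws : 'M[R[i]]_n :=
  G *m \matrix_(j, i) \sum_(w <- ws) ((w 0 j)^*)%C * w 0 i.

Lemma raise_rank_one_sum ws i j :
  raise G (rank_one_sum ws) i j = \sum_(w <- ws) w 0 i * ((w 0 j)^*)%C.
Proof.
transitivity ((invmx G *m rank_one_sum ws) j i); first by rewrite mxE.
rewrite /rank_one_sum mulmxA mulVmx ?mul1mx ?mxE; last exact: posdef_unit.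
by apply: eq_bigr => w _; rewrite mulrC.
Qed.

Lemma herm_rank_one_sum ws u v : herm G (u *m rank_one_sum ws) v
  = \sum_(w <- ws) herm G u w * herm G w v.
Proof.
rewrite herm_mx /rank_one_sum.
have -> : \matrix_(j, i) (\sum_(w <- ws) ((w 0 j)^*)%C * w 0 i)
    = \sum_(w <- ws) (map_mx (@conjc R) w)^T *m w.
  apply/matrixP => j i; rewrite mxE summxE; apply: eq_bigr => w _.
  by rewrite mxE big_ord1 !mxE.
rewrite mulmxA mulmx_sumr !mulmx_suml summxE; apply: eq_bigr => w _.
rewrite !herm_mx !mulmxA -[_ *m w *m G *m _]mulmxA -[_ *m w *m _]mulmxA.
by rewrite mxE big_ord1 !mulmxA.
Qed.

Lemma trace_rank_one_sum ws :
  \tr (rank_one_sum ws) = ((\sum_(w <- ws) normsq G w)%:C)%C.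
Proof.
rewrite rmorph_sum /= /mxtrace.
transitivity (\sum_(w <- ws) herm G w w); last first.
  by apply: eq_bigr => w _; exact: herm_diag.
rewrite /herm exchange_big; apply: eq_bigr => i _ /=; rewrite mxE exchange_big /=.
apply: eq_bigr => j _; rewrite mxE mulr_sumr; apply: eq_bigr => w _.
by ring.
Qed.

Lemma rank_one_sum_weights ws : \sum_(w <- ws) normsq G w = 1 ->
  mean_weights G (rank_one_sum ws).
Proof.
move=> ws1; split=> [u v|u|]; last by rewrite trace_rank_one_sum ws1.
  rewrite (herm_conj posG (v *m _) u) !herm_rank_one_sum rmorph_sum /=.
  apply: eq_bigr => w _; rewrite rmorphM /= -!herm_conj //; ring.
rewrite herm_rank_one_sum sumr_ge0 // => w _.
by rewrite (herm_conj posG u w) mulcJ_ge0.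
Qed.

Lemma herm_curv_mean B v w : herm G (v *m curv_mean G Rm B) w
  = \sum_i \sum_j raise G B i j
      * (\sum_k \sum_l Rm i j k l * v 0 k * ((w 0 l)^*)%C).
Proof.
rewrite herm_mx /curv_mean.
rewrite mulmx_sumr !mulmx_suml summxE; apply: eq_bigr => i _.
rewrite mulmx_sumr !mulmx_suml summxE; apply: eq_bigr => j _.
rewrite -scalemxAr -!scalemxAl mxE; congr (_ * _).
rewrite -(mulmxA v) [LHS]mxE exchange_big; apply: eq_bigr => l _ /=.
rewrite ![in LHS]mxE mulr_suml; apply: eq_bigr => k _.
by rewrite curv_compG ?posdef_unit // (mulrC (v 0 k)).
Qed.

(** Identifies <R_B v, v> with the sum appearing in the first-order condition at an almost
    minimiser. *)
Lemma herm_curv_mean_rank_one_sum ws v :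
  herm G (v *m curv_mean G Rm (rank_one_sum ws)) v
  = \sum_(w <- ws) curv4 Rm w w v v.
Proof.
rewrite herm_curv_mean /curv4 exchange_big /= [RHS]exchange_big /=.
rewrite exchange_big; apply: eq_bigr => i _ /=.
rewrite [RHS]exchange_big; apply: eq_bigr => j _ /=.
rewrite raise_rank_one_sum mulr_suml; apply: eq_bigr => w _.
rewrite mulr_sumr; apply: eq_bigr => k _; rewrite mulr_sumr; apply: eq_bigr => l _.
ring.
Qed.

Lemma le_mu_rc (B : 'M[R[i]]_n) (c : R) : mean_weights G B ->
  (forall v, v != 0 ->
    c * normsq G v <= complex.Re (herm G (v *m curv_mean G Rm B) v)) ->
  (c%:E <= mu_rc G Rm)%E.
Proof.
move=> wB cB; apply: le_trans (ereal_sup_ubound _); last by exists B.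
apply: le_ereal_inf_tmp => _ [v v0 <-].
by rewrite lee_fin ler_pdivlMr ?normsq_gt0 //; exact: cB.
Qed.

End Densities.

(** * Bounds on the mean curvature *)

Section MeanCurvature.
Variables (R : realType) (n : nat) (G : 'M[R[i]]_n).
Hypotheses (n_gt0 : (0 < n)%N) (posG : hermitian_posdef G).
Variable Rm : 'I_n -> 'I_n -> 'I_n -> 'I_n -> R[i].
Hypotheses (Rm13 : forall i j k l, Rm i j k l = Rm k j i l)
  (Rm24 : forall i j k l, Rm i j k l = Rm i l k j).
Implicit Types (u v w x y : 'rV[R[i]]_n) (ws : seq 'rV[R[i]]_n).

(** The map v |-> v P is an isometry onto the standard Hermitian space. *)
Lemma herm_gram (P : 'M[R[i]]_n) u v : G = P *m (map_mx (@conjc R) P)^T ->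
  herm G u v = \sum_a (u *m P) 0 a * (((v *m P) 0 a)^*)%C.
Proof.
move=> GE; rewrite herm_mx GE mulmxA -mulmxA -trmx_mul -map_mxM mxE.
by apply: eq_bigr => a _; rewrite [X in _ * X]mxE [X in _ * X]mxE.
Qed.

Lemma Re_le (x y : R[i]) : x <= y -> complex.Re x <= complex.Re y.
Proof. by rewrite lecE => /andP[]. Qed.

Lemma Re_le_norm (x : R[i]) : complex.Re x <= complex.Re `|x|.
Proof.
rewrite normc_def /= (le_trans (ler_norm _)) // -sqrtr_sqr ler_wsqrtr //.
by rewrite lerDl sqr_ge0.
Qed.

(* Cauchy-Schwarz for the trace: tr B = 1 implies tr (B^2) >= 1 / n. *)
Lemma gram_sum_ge ws : \sum_(w <- ws) normsq G w = 1 ->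
  n%:R^-1 <= \sum_(x <- ws) \sum_(y <- ws)
               complex.Re (herm G x y * herm G y x).
Proof.
move=> ws1; have [P _ GE] := posdef_gram posG.
(* In the orthonormal coordinates w P this is the matrix of sum_w |w><w|: its trace is 1, and the
   double sum is its squared Hilbert-Schmidt norm. *)
pose M a b := \sum_(w <- ws) (w *m P) 0 a * (((w *m P) 0 b)^*)%C.
pose m a := complex.Re (M a a).
have mE a : M a a = ((m a)%:C)%C.
  by rewrite RRe_real // ger0_real // sumr_ge0 // => w _; exact: mulcJ_ge0.
have sum_m : \sum_a m a = 1.
  rewrite -ws1 -raddf_sum /M /= exchange_big raddf_sum /=;
    apply: eq_bigr => w _.
  by rewrite -herm_gram.
have -> : \sum_(x <- ws) \sum_(y <- ws) complex.Re (herm G x y * herm G y x)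
    = complex.Re (\sum_a \sum_b M a b * ((M a b)^*)%C).
  under eq_bigr => x _ do rewrite -raddf_sum.
  rewrite -raddf_sum; congr complex.Re.
  transitivity (\sum_(x <- ws) \sum_(y <- ws) \sum_a \sum_b
    ((x *m P) 0 a * (((x *m P) 0 b)^*)%C)
      * ((((y *m P) 0 a)^*)%C * (y *m P) 0 b)).
    apply: eq_bigr => x _; apply: eq_bigr => y _.
    rewrite !(herm_gram _ _ GE) big_distrlr; apply: eq_bigr => a _.
    by apply: eq_bigr => b _ /=; ring.
  under eq_bigr => x _ do rewrite exchange_big /=.
  rewrite exchange_big; apply: eq_bigr => a _ /=.
  under eq_bigr => x _ do rewrite exchange_big /=.
  rewrite exchange_big; apply: eq_bigr => b _ /=.
  rewrite /M rmorph_sum /= big_distrlr; apply: eq_bigr => x _.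
  by apply: eq_bigr => y _; rewrite rmorphM /= conjcK.
apply: (@le_trans _ _ (\sum_a m a ^+ 2)).
  (* Since the m_a sum to 1, expanding the squares gives sum_a m_a^2 >= 1/n. *)
  have : 0 <= \sum_a (m a - n%:R^-1) ^+ 2 by apply: sumr_ge0 => a _; exact: sqr_ge0.
  have sq a : (m a - n%:R^-1) ^+ 2 = m a ^+ 2 + (- 2 / n%:R * m a + n%:R^-1 ^+ 2).
    by ring.
  under eq_bigr => a _ do rewrite sq.
  rewrite !big_split /= -mulr_sumr sum_m mulr1 sumr_const card_ord.
  rewrite -[_ ^+ 2 *+ n]mulr_natr.
  by rewrite [n%:R^-1 ^+ 2]expr2 mulfVK ?pnatr_eq0 -?lt0n //; lra.
have -> : \sum_a m a ^+ 2 = complex.Re (\sum_a M a a * ((M a a)^*)%C).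
  rewrite raddf_sum /=; apply: eq_bigr => a _.
  by rewrite mE conjc_real -rmorphM expr2.
(* The off-diagonal entries contribute non-negative terms and are dropped. *)
apply: Re_le; apply: ler_sum => a _.
by rewrite (bigD1 a) //= lerDl sumr_ge0 // => b _; exact: mulcJ_ge0.
Qed.

(** A unit vector is v = (v P) P^-1 with the entries of v P at most 1 in modulus; its coordinates
    are thus bounded by A and the form by a sum of |R_ijkl| A^4. *)
Lemma biquad_bounded :
  exists2 K : R, 0 <= K & forall v, normsq G v = 1 -> biquad Rm v v <= K.
Proof.
have [P uP GE] := posdef_gram posG.
pose A : R[i] := \sum_a \sum_i `|invmx P a i|.
have A0 : 0 <= A by apply: sumr_ge0 => a _; apply: sumr_ge0.
pose K : R[i] := \sum_(q : 'I_n * 'I_n * 'I_n * 'I_n)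
  `|Rm q.1.1.1 q.1.1.2 q.1.2 q.2| * A * A * A * A.
have K0 : 0 <= K by apply: sumr_ge0 => q _; rewrite !mulr_ge0.
exists (complex.Re K); first exact: (@Re_le 0).
move=> v v1; apply: le_trans (Re_le_norm _) _; apply: Re_le.
have y1 a : `|(v *m P) 0 a| <= 1.
  rewrite -(@expr_le1 _ 2) // normCK.
  have : herm G v v = 1 by rewrite herm_diag // v1.
  rewrite (herm_gram _ _ GE) => <-.
  by rewrite (bigD1 a) //= lerDl sumr_ge0 // => b _; exact: mulcJ_ge0.
have vA i : `|v 0 i| <= A.
  rewrite -[v](mulmxK uP) mxE; apply: le_trans (ler_norm_sum _ _ _) _.
  apply: ler_sum => a _; rewrite normrM.
  apply: (@le_trans _ _ `|invmx P a i|); first by rewrite ler_piMl.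
  by rewrite (bigD1 i) //= lerDl sumr_ge0.
rewrite curv4E; apply: le_trans (ler_norm_sum _ _ _) _.
apply: ler_sum => q _; rewrite !normrM !norm_conjC.
by rewrite !ler_pM ?mulr_ge0.
Qed.

Lemma mu_rc_ricci :
  (forall u, n.+1%:R * normsq G u <= ricci_quad G Rm u) ->
  ((n.+1%:R / n%:R)%:E <= mu_rc G Rm)%E.
Proof.
move=> ric.
have n0 : (n%:R : R[i]) != 0 by rewrite pnatr_eq0 -lt0n.
apply: (@le_mu_rc _ _ _ posG _ (n%:R^-1)%:M).
  split=> [u v|u|].
  - by rewrite !mul_mx_scalar !herm_mx -!scalemxAl !map_mxZ linearZ /=
      conjc_inv conjc_nat -!scalemxAr.
  - rewrite mul_mx_scalar herm_mx -!scalemxAl mxE -herm_mx herm_diag //.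
    by rewrite mulr_ge0 ?invr_ge0 ?ler0n // lecR normsq_ge0.
  - by rewrite mxtrace_scalar -[_ *+ n]mulr_natr mulVf.
move=> v v0.
have -> : complex.Re (herm G (v *m curv_mean G Rm (n%:R^-1)%:M) v)
    = n%:R^-1 * ricci_quad G Rm v.
  rewrite herm_curv_mean // /ricci_quad.
  have -> : (n%:R^-1 : R) * complex.Re
      (\sum_i \sum_j ricci G Rm i j * v 0 i * ((v 0 j)^*)%C)
    = complex.Re (n%:R^-1 * (\sum_i \sum_j ricci G Rm i j * v 0 i * ((v 0 j)^*)%C)).
    rewrite -(rmorph_nat (real_complex R)) -fmorphV /=.
    by move: (\sum_i _) => [a b]; simpc.
  congr complex.Re; rewrite !pair_bigA mulr_sumr /=.
  transitivity (\sum_(p : 'I_n * 'I_n) \sum_(q : 'I_n * 'I_n)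
     n%:R^-1 * (ginv G q.1 q.2 * Rm p.1 p.2 q.1 q.2) * v 0 p.1 * ((v 0 p.2)^*)%C).
    rewrite exchange_big; apply: eq_bigr => q _ /=.
    have -> : raise G (n%:R^-1)%:M q.1 q.2 = n%:R^-1 * ginv G q.1 q.2.
      rewrite /raise (bigD1 q.1) //= big1 => [|k kq]; rewrite !mxE.
        by rewrite eqxx mulr1n addr0 mulrC.
      by rewrite (negbTE kq) mulr0n mulr0.
    rewrite pair_bigA mulr_sumr; apply: eq_bigr => p _ /=.
    (* The two symmetries exchange the index pairs, turning the trace over the first pair into the
       Ricci contraction over the second. *)
    by rewrite (Rm13 q.1) (Rm24 p.1); ring.
  apply: eq_bigr => p _; rewrite /ricci pair_bigA /= !mulr_suml mulr_sumr.
  by apply: eq_bigr => q _; ring.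
by rewrite -mulrA mulrCA ler_wpM2l ?invr_ge0 ?ler0n //; exact: ric.
Qed.

(* The curvature tensor of constant holomorphic sectional curvature 2. *)
Definition cst_hol_curv (i j k l : 'I_n) : R[i] := G i j * G k l + G i l * G k j.

(** The second summand is the first with its two conjugate indices exchanged. *)
Lemma curv4_cst_hol x y : curv4 cst_hol_curv x x y y
  = herm G x x * herm G y y + herm G x y * herm G y x.
Proof.
have prod u v w s : curv4 (fun i j k l => G i j * G k l) u v w s
    = herm G u v * herm G w s.
  rewrite /curv4 /herm mulr_suml; apply: eq_bigr => i _.
  rewrite mulr_suml; apply: eq_bigr => j _; rewrite mulr_sumr; apply: eq_bigr => k _.
  by rewrite mulr_sumr; apply: eq_bigr => l _; ring.
rewrite -!prod -(curv4_swap24 (fun i j k l => G i j * G k l) x x y y).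
by rewrite !curv4E -big_split; apply: eq_bigr => q _; rewrite /cst_hol_curv /=; ring.
Qed.

Lemma pair_sum_biquad_ge ws :
  (forall u, u != 0 -> 2 <= hol_sect G Rm u) ->
  \sum_(w <- ws) normsq G w = 1 ->
  n.+1%:R / n%:R <= pair_sum (biquad Rm) ws.
Proof.
move=> hol ws1.
pose T i j k l := Rm i j k l - cst_hol_curv i j k l.
have T13 i j k l : T i j k l = T k j i l.
  by rewrite /T (Rm13 i) /cst_hol_curv; ring.
have T24 i j k l : T i j k l = T i l k j.
  by rewrite /T (Rm24 i) /cst_hol_curv; ring.
have TE x y : biquad T x y = biquad Rm x y
    - (normsq G x * normsq G y + complex.Re (herm G x y * herm G y x)).
  rewrite /biquad curv4B raddfB /= curv4_cst_hol raddfD /=.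
  by rewrite !herm_diag // -rmorphM.
have T_ge0 u : 0 <= biquad T u u.
  (* On the diagonal the subtracted tensor equals 2 |u|^4, so the bound on H gives the sign for u !=
     0; u = 0 is treated separately. *)
  rewrite TE !herm_diag // -rmorphM /=.
  have [->|u0] := eqVneq u 0.
    rewrite normsq0 !mul0r addr0 subr0 /biquad curv4E big1 // => q _.
    by rewrite !mxE mulr0 !mul0r.
  have := hol u u0; rewrite /hol_sect ler_pdivlMr; last first.
    by rewrite exprn_gt0 // normsq_gt0.
  by rewrite /biquad; lra.
have := pair_sum_ge0 (biquad_sym T13 T24) (biquad_phase T) 
  (biquad_phase_diag T13 T24) T_ge0 ws.
rewrite /pair_sum.
under eq_bigr => x _ do (under eq_bigr => y _ do rewrite TE); rewrite /=.
under eq_bigr => x _ do rewrite sumrB big_split -mulr_sumr ws1 mulr1.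
rewrite sumrB big_split /= ws1 => h.
have := gram_sum_ge ws1.
have -> : n.+1%:R / n%:R = 1 + n%:R^-1 :> R.
  by rewrite -addn1 natrD mulrDl mul1r mulfV // pnatr_eq0 -lt0n.
lra.
Qed.

Lemma mu_rc_hol_sect :
  (forall u, u != 0 -> 2 <= hol_sect G Rm u) ->
  ((n.+1%:R / n%:R)%:E <= mu_rc G Rm)%E.
Proof.
(* It suffices to reach the bound up to every e > 0, so an almost minimiser serves as B. *)
move=> hol; apply/lee_addgt0Pr => e e0.
have [K K0 hK] := biquad_bounded.
have unit_vec v : v != 0 -> normsq G ((((Num.sqrt (normsq G v))^-1)%:C)%C *: v) = 1.
  move=> v0; rewrite normsq_scale exprVn sqr_sqrtr ?normsq_ge0 // mulVf //.
  by rewrite gt_eqF // normsq_gt0.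
have ex_unit : exists v, normsq G v = 1.
  (* This vector is nonzero because n >= 1; normalising it gives a unit vector. *)
  pose v0 : 'rV[R[i]]_n := const_mx 1.
  have v00 : v0 != 0.
    apply/eqP => /rowP/(_ (Ordinal n_gt0)); rewrite !mxE => /eqP.
    by rewrite oner_eq0.
  by eexists; exact: unit_vec v00.
have c0 : 0 <= n.+1%:R / n%:R :> R by rewrite divr_ge0.
have [ws ws1 wsP] := near_minimiser (biquad_sym Rm13 Rm24) (biquad_scale Rm)
  (normsq_scale G) c0 K0 e0 ex_unit hK (fun ws => pair_sum_biquad_ge hol).
rewrite -[X in (X%:E <= _)%E](subrK e) EFinD leeD2r //.
apply: (le_mu_rc posG (rank_one_sum_weights posG ws1)) => v v0.
rewrite herm_curv_mean_rank_one_sum // raddf_sum /=.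
(* Homogeneity extends the condition from unit vectors to all nonzero v. *)
have scale (a : R) p : biquad Rm p ((a%:C)%C *: v) = a ^+ 2 * biquad Rm p v.
  by rewrite (biquad_sym Rm13 Rm24) biquad_scale (biquad_sym Rm13 Rm24).
have := wsP _ (unit_vec v v0).
rewrite (eq_bigr _ (fun p _ => scale _ p)) -mulr_sumr exprVn sqr_sqrtr ?normsq_ge0 //.
by rewrite ler_pdivlMl ?normsq_gt0 // mulrC.
Qed.

End MeanCurvature.

(** * From the geometry in a chart to the pointwise bounds *)

Unset Implicit Arguments.

Theorem lemma2p2 (R : realType) (n : nat) (X : topologicalType)
    (M : complexManifold R X n) (omega : kahlerMetric M) :
  (1 <= n)%N ->
  connected [set: X] ->
  ricci_ge omega n.+1%:R \/ hol_sect_ge omega 2%:R ->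
  forall (x : X) (a : chart R X n), atlas M a -> dom a x ->
    ((n.+1%:R / n%:R)%:E <= mu_rc_at omega a x)%E.
Proof.
move=> n_gt0 _ curv_ge x a atlas_a dom_ax.
have [img_ax _] := Defs.coordK dom_ax.
have posG := metric_posdef omega atlas_a img_ax.
(* The Kähler condition enters only through these two symmetries; the rest is Hermitian linear
   algebra at the point x. *)
have sym13 := curv_swap13 (img_open (c := a)) (metric_smooth omega atlas_a)
  (metric_closed omega atlas_a) img_ax.
have sym24 := curv_swap24 (img_open (c := a))
  (metric_closed_bar omega atlas_a) img_ax.
case: curv_ge => [ric|hol].
  exact: mu_rc_ricci n_gt0 posG _ sym13 sym24 (ric a x atlas_a dom_ax).
exact: mu_rc_hol_sect n_gt0 posG _ sym13 sym24 (hol a x atlas_a dom_ax).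
Qed.
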